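(* Let $K$ be a finite simplicial complex with a discrete Morse function and associated gradient vector field $V$. For a critical $(n+1)$-simplex $\alpha$, $\Gamma$ the set of critical $(n-1)$-simplices, and $\mathcal{F}(\alpha,\gamma)$ the set of critical flowlines from $\alpha$ to $\gamma$, we have $$\sum_{\gamma\in\Gamma}\ \sum_{\widetilde{F}\in\mathcal{F}(\alpha,\gamma)}\theta(\widetilde{F})\cdot\gamma=0$$ in the free abelian group generated by the critical $(n-1)$-simplices.
   Context: A simplicial complex $K$ is a collection of finite nonempty subsets (simplices) of a vertex set closed under taking nonempty subsets; $\sigma^{(p)}$ denotes a simplex of dimension $p$; a facet of $\sigma^{(p)}$ is a face of dimension $p-1$. A discrete Morse function is $f:K\to\mathbb{R}$ such that for each $\beta^{(p)}$ there is at most one facet $\gamma^{(p-1)}<\beta$ with $f(\gamma)\ge f(\beta)$ and at most one $\alpha^{(p+1)}>\beta$ with $f(\alpha)\le f(\beta)$. Its gradient vector field $V$ is the set of pairs $\{\sigma^{(p)}<\tau^{(p+1)}\}$ with $f(\sigma)\ge f(\tau)$; each simplex is in at most one pair. A simplex in no pair of $V$ is critical. The modified Hasse diagram has an arrow $\tau\to\sigma$ for each facet $\sigma$ of $\tau$, except that for each pair $\{\sigma<\tau\}\in V$ the arrow is reversed to $\sigma\to\tau$ (a Morse arrow). A flowline is a directed path in the modified Hasse diagram from a critical simplex $\alpha$ to a critical simplex $\gamma$; its index is $\mathrm{Ind}=\dim\alpha-\dim\gamma$. A flowline of index 2 contains exactly one double drop (two consecutive down steps) $\alpha_i\to\beta\to\gamma_i$;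 $\beta$ is its intermediate simplex. It is a critical flowline if its intermediate simplex is a critical simplex. Signs: fix a total order on the vertices of $K$. If $\tau=[v_0,\dots,v_m]$ is written with vertices in order and $\sigma=\tau\setminus\{v_i\}$, the arrow $a$ between $\tau$ and $\sigma$ (in either direction) has sign $\theta(a)=(-1)^i$. A path $P$ with $\ell(P)$ arrows and index $\mathrm{Ind}(P)$ (dimension of its first simplex minus dimension of its last) has sign $$\theta(P)=\Big(\prod_{a\in P}\theta(a)\Big)(-1)^{\frac{\ell(P)-\mathrm{Ind}(P)}{2}}.$$ *)

(* Defs.v *)
From HB Require Import structures.
From mathcomp Require Import all_boot all_order all_algebra.
From mathcomp Require Import reals.
From mathcomp Require Export freeg.

Set Implicit Arguments.
Unset Strict Implicit.
Unset Printing Implicit Defensive.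

Import Order.TTheory GRing.Theory Num.Theory.
Local Open Scope ring_scope.

Section Complex.
Context (disp : Order.disp_t) (T : finOrderType disp).
Implicit Types (K : {set {set T}}) (s t : {set T}).

Definition simplicial_complex K : Prop :=
  set0 \notin K /\
  forall s t, t \in K -> s \subset t -> s != set0 -> s \in K.

(* Integer-valued, so that facets of vertices and negative indices cause no
   truncation. *)
Definition simplex_dim s : int := #|s|%:Z - 1.

Definition facet K s t : bool :=
  [&& s \in K, t \in K, s \subset t & simplex_dim s == simplex_dim t - 1].

(* [facet_sign s t] is (-1)^i when t = [v_0, ..., v_m] in increasing order and
   s = t \ {v_i}: the index i is that of the first vertex of t not in s. *)
Definition facet_sign s t : int :=
  (-1) ^+ find (fun v => v \notin s) (sort <=%O (enum t)).

(* Sign of an arrow from s to t, whichever of the two is the facet. *)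
Definition arrow_sign s t : int :=
  if t \subset s then facet_sign t s else facet_sign s t.

(* A path is the sequence of the simplices it visits. *)
Implicit Type p : seq {set T}.

Definition path_index p : int :=
  simplex_dim (head set0 p) - simplex_dim (last set0 p).

Definition path_length p : nat := (size p).-1.

(* The exponent (l(p) - Ind(p)) / 2 is the number of upward arrows of p. *)
Definition path_sign p : int :=
  (\prod_(a <- zip p (behead p)) arrow_sign a.1 a.2) *
  (-1) ^ (((path_length p)%:Z - path_index p) %/ 2)%Z.

End Complex.

Section Morse.
Context (R : realType) (disp : Order.disp_t) (T : finOrderType disp).
Context (K : {set {set T}}) (f : {set T} -> R).
Implicit Types (s t : {set T}) (p : seq {set T}).

(* Only the values of f on K matter. *)
Definition discrete_morse_function : Prop :=
  forall b, b \in K ->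
    (#|[set c | facet K c b & (f c >= f b)%R]| <= 1)%N /\
    (#|[set a | facet K b a & (f a <= f b)%R]| <= 1)%N.

Definition gradient_vector_field : {set {set T} * {set T}} :=
  [set st | facet K st.1 st.2 & f st.1 >= f st.2].

Definition critical s : bool :=
  (s \in K) &&
  [forall st in gradient_vector_field, (s != st.1) && (s != st.2)].

Definition critical_simplices (d : int) : {set {set T}} :=
  [set s | critical s & simplex_dim s == d].

Definition hasse_arrow s t : bool :=
  (facet K t s && ((t, s) \notin gradient_vector_field)) ||
  ((s, t) \in gradient_vector_field).

Definition flowline s t p : bool :=
  [&& critical s, critical t, p != [::], head set0 p == s,
      last set0 p == t & sorted hasse_arrow p].

(* b is the middle of a double drop of p; in a discrete Morse gradient, a
   flowline of index 2 has exactly one double drop. *)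
Definition intermediate_simplex p b : bool :=
  [exists a, exists c, [&& infix [:: a; b; c] p, facet K b a & facet K c b]].

Definition critical_flowline s t p : bool :=
  [&& flowline s t p, path_index p == 2
    & [exists b, intermediate_simplex p b && critical b]].

(* Flowlines visit each simplex of K at most once, so bounding their number of
   simplices by #|K| loses none of them: see [mem_critical_flowlines]. *)
Definition critical_flowlines s t : {set #|K|.-bseq {set T}} :=
  [set p : #|K|.-bseq {set T} | critical_flowline s t p].

Lemma flowline_size s t (p : seq {set T}) : flowline s t p -> (size p <= #|K|)%N.
Proof.
case/and5P=> /andP[sK _] _ p0 /eqP hp /andP[_ sp].
pose r (x y : {set T}) :=
  (f y < f x) || ((f y == f x) && (#|x| < #|y|)%N).
have r_tr : transitive r.
  move=> y x z /orP[xy|/andP[/eqP xy cxy]] /orP[yz|/andP[/eqP yz cyz]].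
  - by rewrite /r (lt_trans yz xy).
  - by rewrite /r yz xy.
  - by rewrite /r -xy yz.
  - by rewrite /r yz xy eqxx (ltn_trans cxy cyz) orbT.
have r_irr : irreflexive r by move=> x; rewrite /r ltxx ltnn andbF.
have sub_r : subrel hasse_arrow r.
  move=> x y /orP[/andP[fyx]|]; rewrite inE /=.
    by rewrite fyx /= -ltNge /r => ->.
  case/andP=> /and4P[_ _ _ /eqP dxy] le_yx.
  rewrite /r; move: le_yx; rewrite le_eqVlt => /orP[->|->//].
  have -> : (#|x| < #|y|)%N; last by rewrite orbT.
  move: dxy; rewrite /simplex_dim => /addIr dxy.
  by rewrite -ltz_nat dxy ltrBlDr ltrDl.
have p_uniq : uniq p := sorted_uniq r_tr r_irr (sub_sorted sub_r sp).
have pK : {subset p <= K}.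
  case: p p0 hp sp {p_uniq} => // x q _ /= -> {x} sq y.
  rewrite inE => /predU1P[->//|yq].
  elim: q s sK sq yq => // z q IH x xK /= /andP[xz zq].
  have zK : z \in K.
    by case/orP: xz => [/andP[/and4P[]]//|]; rewrite inE => /andP[/and4P[]].
  by rewrite inE => /predU1P[->//|]; apply: IH zK zq.
by rewrite -(card_uniqP p_uniq); apply/subset_leq_card/subsetP.
Qed.

Lemma mem_critical_flowlines s t (p : seq {set T}) :
  critical_flowline s t p <->
  exists2 q : #|K|.-bseq {set T}, q \in critical_flowlines s t & p = q.
Proof.
split=> [cp|[q]]; last by rewrite inE => cq ->.
have /and3P[/flowline_size sz _ _] := cp.
by exists (Bseq sz); rewrite ?inE.
Qed.

End Morse.

(* Main.v *)
Require Import Defs.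
From mathcomp Require Import all_boot all_order all_algebra.
From mathcomp Require Import reals.

Import Order.TTheory GRing.Theory Num.Theory.
Local Open Scope ring_scope.

Set Implicit Arguments.
Unset Strict Implicit.
Unset Printing Implicit Defensive.

(** The statement says that the boundary map of the Morse complex squares to
zero.  Write [flow s t] for the sum of the signs of all directed paths from [s]
to [t]; the modified Hasse diagram is acyclic, so this satisfies the one-step
recursion [flow_rec].  A path of index 2 between critical simplices is a
critical flowline exactly when it meets a critical simplex of the middle
dimension, and cutting it there writes the signed count of critical flowlines
as the sum over critical [beta] of [flow alpha beta * flow beta gamma]
([pathsum_through], [critical_flowlineE]).

That this sum vanishes follows from the vanishing of the square of the
simplicial boundary ([incidence_comp]), in a cochain form.  For a critical [t],
regard [flow _ t] as a cochain in dimension [dim t].  Call a simplex lower or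
upper according to its place in a gradient pair.  Since a step up a pair carries
the opposite of its incidence number, the coboundary of [flow _ t] vanishes on
upper simplices, and on a critical [s] it takes the value [flow s t]
([coboundary_flow]).  Let
  [h = coboundary (flow _ gamma) - \sum_beta flow beta gamma * flow _ beta],
a cochain in the dimension of the [beta].  It vanishes on critical and on upper
simplices, and its coboundary vanishes on upper simplices.  If [l] is lower with
partner [u], the other facets of [u] lie further down the flow, so the equation
[coboundary h u = 0] determines [h l] from values that are zero by induction;
hence [h = 0].  Evaluating [coboundary h] at [alpha] gives the result
([flow_comp]). *)

(** * Signed path sums in a finite acyclic digraph *)

Section PathSums.
Context (A : pzRingType) (S : finType) (w : S -> S -> A) (r : rel S).
Hypotheses (r_tr : transitive r) (r_irr : irreflexive r).
Hypothesis w_r : forall s x, w s x != 0 -> r s x.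
Implicit Types (s t x : S) (q : seq S) (P : pred (seq S)).

Lemma acyclic_ind (Q : S -> Prop) :
  (forall s, (forall x, r s x -> Q x) -> Q s) -> forall s, Q s.
Proof.
move=> IH s; have [n] := ubnP #|[set x | r s x]|.
elim: n s => // n IHn s /ltnSE le_n; apply: IH => x sx; apply: IHn.
apply: leq_trans le_n; apply: proper_card; apply/properP; split.
  by apply/subsetP=> y; rewrite !inE; apply: r_tr.
by exists x; rewrite !inE ?sx // r_irr.
Qed.

Definition path_weight s q : A := \prod_(a <- zip (s :: q) q) w a.1 a.2.

Lemma path_weight_cons s x q : path_weight s (x :: q) = w s x * path_weight x q.
Proof. by rewrite /path_weight big_cons. Qed.

Lemma path_weight_neq0 s q :
  path_weight s q != 0 -> path (fun a b => w a b != 0) s q.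
Proof.
elim: q s => //= x q IH s; rewrite path_weight_cons.
by have [->|_] := eqVneq (w s x) 0; rewrite ?mul0r ?eqxx //= => wq;
   apply: IH; apply: contraNneq wq => ->; rewrite mulr0.
Qed.

(** Bounding the length by [#|S|] keeps every path of nonzero weight, because
[r] is acyclic; see [pathsum_seq]. *)
Definition pathsum P s : A := \sum_(q : #|S|.-bseq S | P q) path_weight s q.


Lemma path_weight_path s q : path_weight s q != 0 -> path r s q.
Proof. by move/path_weight_neq0/(sub_path w_r). Qed.

(** Any duplicate-free list containing the paths of nonzero weight computes the
path sum: this frees the later arguments from the particular length bound. *)
Lemma pathsum_seq P s (qs : seq (seq S)) : uniq qs ->
    (forall q, path_weight s q != 0 -> P q -> q \in qs) ->
  pathsum P s = \sum_(q <- qs | P q) path_weight s q.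
Proof.
move=> qs_uniq qs_all.
pose words : seq (seq S) := map val (enum {: #|S|.-bseq S}).
have -> : pathsum P s = \sum_(q <- words | P q) path_weight s q.
  by rewrite big_map big_enum_cond.
(* Once the terms of weight zero are discarded, both sums range over the same
   paths. *)
rewrite !(bigID (fun q => path_weight s q == 0) P) /=.
have zeros (us : seq (seq S)) :
    \sum_(q <- us | P q && (path_weight s q == 0)) path_weight s q = 0.
  by apply: big1 => q /andP[_ /eqP].
rewrite !zeros !add0r.
rewrite -big_filter -[RHS]big_filter; apply: perm_big; apply: uniq_perm.
- rewrite filter_uniq // map_inj_uniq ?enum_uniq //; exact: val_inj.
- exact: filter_uniq.
move=> q; rewrite !mem_filter; have [Pq|//] := boolP (P q).
have [//|wq] /= := eqVneq (path_weight s q) 0; rewrite qs_all //.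
apply/mapP; suff szq : (size q <= #|S|)%N.
  by exists (Bseq szq); rewrite ?mem_enum.
have /card_uniqP/= <- : uniq q.
  have: uniq (s :: q).
    by apply: (sorted_uniq r_tr r_irr); apply: path_weight_path.
  by case/andP.
exact: max_card.
Qed.

Lemma pathsum_rec P s :
  pathsum P s
  = (P [::])%:R + \sum_x w s x * pathsum (fun q => P (x :: q)) x.
Proof.
pose words : seq (seq S) := map val (enum {: #|S|.-bseq S}).
rewrite (@pathsum_seq P s ([::] :: [seq x :: q | x <- enum S, q <- words])).
- rewrite big_cons big_mkcond big_allpairs_dep /= big_enum /=.
  have -> : path_weight s [::] = 1 by rewrite /path_weight big_nil.
  have -> z : (if P [::] then 1 + z else z) = (P [::])%:R + z.
    by case: (P _); rewrite ?add0r.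
  congr (_ + _); apply: eq_bigr => x _.
  rewrite -big_mkcond big_map big_enum_cond mulr_sumr /=.
  by apply: eq_bigr => q _; rewrite path_weight_cons.
- rewrite /= allpairs_uniq ?enum_uniq ?andbT //.
  + by apply/negP=> /allpairsP[[a b] []].
  + by rewrite map_inj_uniq ?enum_uniq //; apply: val_inj.
  + by move=> [a b] [c d] _ _ [-> ->].
move=> q wq _; rewrite inE; case: q wq => //= x q /path_weight_path.
move=> /= /andP[_] /(@sorted_uniq _ _ r_tr r_irr (x :: q)) /andP[_ q_uniq].
apply/allpairsP; exists (x, q); rewrite mem_enum; split=> //.
apply/mapP; suff szq : (size q <= #|S|)%N.
  by exists (Bseq szq); rewrite ?mem_enum.
by have /card_uniqP/= <- := q_uniq; apply: max_card.
Qed.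

Lemma pathsum_eq0 P s :
  (forall q, path (fun a b => w a b != 0) s q -> ~~ P q) -> pathsum P s = 0.
Proof.
move=> noP; apply: big1 => q Pq; apply/eqP; apply: contraTT Pq => wq.
exact/noP/path_weight_neq0.
Qed.

Definition flow s t : A := pathsum (fun q => last s q == t) s.

Lemma flow_rec s t : flow s t = (s == t)%:R + \sum_x w s x * flow x t.
Proof. exact: pathsum_rec. Qed.

Lemma flow_refl s : flow s s = 1.
Proof.
rewrite flow_rec eqxx big1 ?addr0 // => x _.
have [->|wsx] := eqVneq (w s x) 0; first by rewrite mul0r.
rewrite [flow x s]pathsum_eq0 ?mulr0 // => q /(sub_path w_r) pq.
have /allP rs : all (r s) (x :: q).
  by apply: order_path_min => //=; rewrite w_r.
apply/eqP=> last_q; have := rs _ (mem_last x q).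
by rewrite last_q r_irr.
Qed.

(** If no path joins two points of [B], each path meeting [B] is cut there in
exactly one way.  Both sides obey the same recursion away from [B] and agree on
[B], so induction along the digraph replaces the bijection between paths and
pairs of paths. *)
Lemma pathsum_through (B : {set S}) s t :
    {in B &, forall b c, b != c -> flow b c = 0} ->
  pathsum (fun q => (last s q == t) && has (mem B) (s :: q)) s
  = \sum_(b in B) flow s b * flow b t.
Proof.
move=> B0; elim/acyclic_ind: s => s IH.
have [sB|sB] := boolP (s \in B).
  rewrite (bigD1 s) //= flow_refl mul1r big1 ?addr0; last first.
    by move=> b /andP[bB bs]; rewrite B0 ?mul0r // eq_sym.
  by apply: eq_bigl => q; rewrite sB andbT.
transitivity (\sum_x w s x * \sum_(b in B) flow x b * flow b t).
  rewrite pathsum_rec /= orbF (negPf sB) andbF add0r.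
  apply: eq_bigr => x _.
  have [->|wsx] := eqVneq (w s x) 0; first by rewrite !mul0r.
  by rewrite -IH ?w_r.
under eq_bigr => x _ do rewrite mulr_sumr.
rewrite exchange_big /=; apply: eq_bigr => b bB.
rewrite (flow_rec s b); have -> : (s == b) = false.
  by apply: contraNF sB => /eqP->.
by rewrite add0r mulr_suml; apply: eq_bigr => x _; rewrite mulrA.
Qed.
End PathSums.
(** * The simplicial boundary squares to zero *)

Section Boundary.
Context (disp : Order.disp_t) (T : finOrderType disp) (K : {set {set T}}).
Implicit Types (s t x : {set T}) (a b : T).

Lemma facet_sign_setD1 t a : a \in t ->
  facet_sign (t :\ a) t = (-1) ^+ #|[set v in t | (v < a)%O]|.
Proof.
move=> ta; congr (_ ^+ _); set L := sort _ _.
have memL : L =i t by move=> v; rewrite mem_sort mem_enum.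
have -> : find (fun v => v \notin t :\ a) L = index a L.
  apply: eq_in_find => v; rewrite memL !inE => ->.
  by rewrite andbT negbK.
have idx : (index a L < size L)%N by rewrite index_mem memL.
have L_lt : sorted <%O L by rewrite sort_lt_sorted; apply: enum_uniq.
rewrite -[LHS](count_lt_nth a L_lt idx) nth_index ?memL // cardE -size_filter.
apply/perm_size/uniq_perm; first by rewrite filter_uniq ?sort_uniq ?enum_uniq.
  exact: enum_uniq.
by move=> v; rewrite mem_filter memL mem_enum !inE andbC.
Qed.

Lemma facet_setD1 t a :
  t \in K -> a \in t -> t :\ a \in K -> facet K (t :\ a) t.
Proof.
move=> tK ta sK; rewrite /facet sK tK subD1set /simplex_dim /=.
by rewrite (cardsD1 a t) ta PoszD [true%:Z + _]addrC addrK.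
Qed.

Lemma facet_dim s t : facet K s t -> simplex_dim t = simplex_dim s + 1.
Proof. by case/and4P=> _ _ _ /eqP ->; rewrite subrK. Qed.

Lemma facet_dim_lt s t : facet K s t -> simplex_dim s < simplex_dim t.
Proof. by move/facet_dim->; rewrite ltrDl. Qed.

Lemma facet_setD1_ex s t : facet K s t -> exists2 a, a \in t & s = t :\ a.
Proof.
case/and4P=> sK tK st /eqP dim_s.
have /cards1P[a ats] : #|t :\: s| == 1%N.
  have card_t : #|t| = #|s|.+1.
    apply/eqP; rewrite -eqz_nat -addn1 PoszD.
    by rewrite /simplex_dim in dim_s; rewrite (addIr _ dim_s) subrK.
  by rewrite cardsD (setIidPr st) card_t subSnn.
exists a; first by have := set11 a; rewrite -ats inE => /andP[].
by rewrite -ats setDDr setDv set0U (setIidPr st).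
Qed.

Definition incidence t s : int := if facet K s t then facet_sign s t else 0.

Lemma incidence_facet t s : incidence t s != 0 -> facet K s t.
Proof. by rewrite /incidence; case: ifP; rewrite ?eqxx. Qed.

(** The two ways of deleting [a] and [b] differ by a sign: [a] comes before [b],
so its deletion shifts the position of [b] by one, while deleting [b] leaves the
position of [a] unchanged. *)
Lemma facet_sign_setD2 t a b : a \in t -> b \in t -> (a < b)%O ->
  facet_sign (t :\ b) t * facet_sign (t :\ b :\ a) (t :\ b)
  + facet_sign (t :\ a) t * facet_sign (t :\ a :\ b) (t :\ a) = 0.
Proof.
move=> ta tb lt_ab; have ne_ab := lt_eqF lt_ab.
rewrite !facet_sign_setD1 ?inE ?ta ?tb ?ne_ab 1?eq_sym ?ne_ab //.
have -> : [set v in t :\ b | (v < a)%O] = [set v in t | (v < a)%O].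
  apply/setP=> v; rewrite !inE; have [->|] //= := eqVneq v b.
  by rewrite [(b < a)%O]lt_gtF ?andbF.
rewrite [#|[set v in t | (v < b)%O]|](cardsD1 a) !inE ta lt_ab /=.
have -> : [set v in t :\ a | (v < b)%O] = [set v in t | (v < b)%O] :\ a.
  by apply/setP=> v; rewrite !inE andbA.
by rewrite exprS mulN1r mulNr mulrC addNr.
Qed.

Lemma incidence_comp (Kc : simplicial_complex K) t s :
  \sum_x incidence t x * incidence x s = 0.
Proof.
have [noint|] := boolP [forall x, incidence t x * incidence x s == 0].
  by apply: big1 => x _; apply/eqP/(forallP noint).
rewrite negb_forall => /existsP[x]; rewrite mulf_eq0 negb_or.
case/andP=> /incidence_facet xt /incidence_facet sx.
have [sK tK] : s \in K /\ t \in K by case/and4P: sx; case/and4P: xt.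
have [b tb def_x] := facet_setD1_ex xt.
have [a xa def_s] := facet_setD1_ex sx.
rewrite {}def_x in def_s xa xt sx; rewrite {}def_s in sx sK *.
move: xa; rewrite !inE => /andP[ne_ab ta] {x}.
have sub_K (y : {set T}) : t :\ b :\ a \subset y -> y \subset t -> y \in K.
  move=> sy yt; apply: (Kc.2 _ _ tK yt); apply: contraNneq Kc.1 => y0.
  by move: sy sK; rewrite y0 subset0 => /eqP ->.
have ss : t :\ b :\ a = t :\ a :\ b by apply/setP=> v; rewrite !inE andbCA.
have facets : [/\ facet K (t :\ b) t, facet K (t :\ b :\ a) (t :\ b),
                  facet K (t :\ a) t & facet K (t :\ a :\ b) (t :\ a)].
  have aK : t :\ a \in K by rewrite sub_K ?subD1set // ss subD1set.
  by split=> //; apply: facet_setD1; rewrite -?ss ?inE ?tb ?[b == _]eq_sym ?ne_ab.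
rewrite (bigD1 (t :\ b)) //= (bigD1 (t :\ a)) /=; last first.
  by apply: contraNneq ne_ab => /setP/(_ a); rewrite !inE ta eqxx andbT; case: eqP.
rewrite addrA big1 ?addr0.
  rewrite /incidence; case: facets => -> -> -> fab; rewrite ss fab.
  have := @facet_sign_setD2 t; case/orP: (lt_total ne_ab) => lt_ab.
    by move/(_ a b ta tb lt_ab); rewrite ss.
  by move/(_ b a tb ta lt_ab); rewrite ss addrC.
move=> y /andP[yb ya]; apply/eqP; rewrite mulf_eq0 -[_ || _]negbK negb_or.
apply/negP=> /andP[/incidence_facet yt /incidence_facet sy].
have [c tc def_y] := facet_setD1_ex yt.
have : c \notin t :\ b :\ a.
  by case/and4P: sy => _ _ /subsetP sy _; apply/negP=> /sy; rewrite def_y !inE eqxx.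
rewrite !inE tc andbT negb_and !negbK => /orP[]/eqP def_c.
  by rewrite def_y def_c eqxx in ya.
by rewrite def_y def_c eqxx in yb.
Qed.
End Boundary.
(** * Gradient pairs *)

Section GradientFlow.
Context (R : realType) (disp : Order.disp_t) (T : finOrderType disp).
Context (K : {set {set T}}) (f : {set T} -> R).
Hypotheses (Kc : simplicial_complex K) (fM : discrete_morse_function K f).
Implicit Types (s t u x : {set T}) (q : seq {set T}).

Local Notation V := (gradient_vector_field K f).
Local Notation arrow := (hasse_arrow K f).
Local Notation dim := (@simplex_dim disp T).
Local Notation critical := (critical K f).

Lemma pair_facet s t : (s, t) \in V -> facet K s t.
Proof. by rewrite inE => /andP[]. Qed.

Lemma pair_top_inj s t t' : (s, t) \in V -> (s, t') \in V -> t = t'.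
Proof.
rewrite !inE /= => /andP[st le_ts] /andP[st' le_ts'].
have [sK _ _ _] := and4P st; have [_ /card_le1_eqP] := fM sK.
by apply; rewrite inE ?st ?st'.
Qed.

Lemma pair_bottom_inj s s' t : (s, t) \in V -> (s', t) \in V -> s = s'.
Proof.
rewrite !inE /= => /andP[st le_ts] /andP[st' le_ts'].
have [_ tK _ _] := and4P st; have [/card_le1_eqP le1 _] := fM tK.
by apply: le1; rewrite inE ?st ?st'.
Qed.

(** The diamond argument: between [s] and [u] lies a second simplex [x] besides
[t].  As [t] is the only exception for [s] and for [u], [f s < f x < f u],
whereas the two pairs would give [f u <= f t <= f s]. *)
Lemma pairs_disjoint s t u : (s, t) \in V -> (t, u) \notin V.
Proof.
move=> stV; apply/negP=> tuV.
have [st tu] := (pair_facet stV, pair_facet tuV).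
have [sK tK uK] : [/\ s \in K, t \in K & u \in K].
  by case/and4P: st; case/and4P: tu.
have [b ub def_t] := facet_setD1_ex tu; have [a ta def_s] := facet_setD1_ex st.
rewrite {t}def_t in def_s tu ta tK tuV stV st; rewrite {s}def_s in sK stV st.
move: ta; rewrite !inE => /andP[ne_ab ua].
have su : u :\ b :\ a = u :\ a :\ b by apply/setP=> v; rewrite !inE andbCA.
have xK : u :\ a \in K.
  apply: (Kc.2 _ _ uK (subD1set _ _)); apply: contraNneq Kc.1 => x0.
  by move: sK; rewrite su x0 set0D.
have xu := facet_setD1 uK ua xK.
have sx : facet K (u :\ b :\ a) (u :\ a).
  by rewrite su; apply: facet_setD1; rewrite -?su // !inE eq_sym ne_ab.
have ne_x : u :\ a != u :\ b.
  by apply: contraNneq ne_ab => /setP/(_ a); rewrite !inE ua eqxx andbT; case: eqP.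
have lt_sx : f (u :\ b :\ a) < f (u :\ a).
  rewrite ltNge; apply: contra ne_x => le_xs.
  by apply/eqP/(@pair_top_inj (u :\ b :\ a)) => //; rewrite inE sx.
have lt_xu : f (u :\ a) < f u.
  rewrite ltNge; apply: contra ne_x => le_ux.
  by apply/eqP/(@pair_bottom_inj _ _ u) => //; rewrite inE xu.
move: stV tuV; rewrite !inE => /andP[_ /= le_ts] /andP[_ /= le_ut].
by have := lt_trans lt_sx lt_xu; rewrite ltNge (le_trans le_ut).
Qed.

Definition lower s : bool := [exists t, (s, t) \in V].

Lemma critical_unpaired s t :
  critical s -> ((s, t) \in V) = false /\ ((t, s) \in V) = false.
Proof.
case/andP=> _ /'forall_implyP/= cs.
by split; apply/negP=> /cs; rewrite eqxx ?andbF.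
Qed.

Lemma critical_lowerN s : critical s -> ~~ lower s.
Proof. by move=> cs; apply/existsPn=> t; rewrite (critical_unpaired t cs).1. Qed.

Lemma unpaired_critical s :
  s \in K -> ~~ lower s -> (forall t, (t, s) \notin V) -> critical s.
Proof.
move=> sK /existsPn lows ups; rewrite /Defs.critical sK.
apply/'forall_implyP=> -[a b] abV /=; apply/andP; split.
  by apply: contraTneq abV => <-; apply: lows.
by apply: contraTneq abV => <-; apply: ups.
Qed.

(** A step down strictly decreases [f].  A step up a gradient pair may leave [f]
unchanged, and then the decrease comes from the second component. *)
Definition height s : (R *l int)%type := (f s, - dim s).

Definition descends : rel {set T} := fun s t => (height t < height s)%O.

Lemma descends_trans : transitive descends.
Proof. by move=> t s u st tu; apply: lt_trans tu st. Qed.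

Lemma descends_irr : irreflexive descends.
Proof. by move=> s; apply: ltxx. Qed.

Lemma arrow_descends s t : arrow s t -> descends s t.
Proof.
rewrite /descends ltxi_pair => /orP[/andP[ts]|stV].
  by rewrite inE ts /= -ltNge => /[dup] /ltW -> /lt_geF ->.
have -> : f t <= f s by move: stV; rewrite inE => /andP[].
by rewrite (facet_dim (pair_facet stV)) ltrN2 ltrDl ltr01 implybT.
Qed.

(** The factor contributed to [path_sign] by a step from [s] to [t]:
distributing the power of -1 over the upward steps negates each of their signs.
The weight is 0 when there is no arrow. *)
Definition arrow_weight s t : int :=
  (if (t, s) \in V then 0 else incidence K s t)
  - (if (s, t) \in V then incidence K t s else 0).

Lemma facet_asym s t : facet K s t -> facet K t s = false.
Proof.
move=> st; apply: contraTF (facet_dim_lt st) => /facet_dim_lt ts.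
by rewrite lt_gtF.
Qed.

Lemma pairs_asym s t : (s, t) \in V -> ((t, s) \in V) = false.
Proof. by move/(pairs_disjoint s)/negPf. Qed.

Lemma arrow_weight_down s t :
  facet K t s -> (t, s) \notin V -> arrow_weight s t = facet_sign t s.
Proof.
move=> ts tsV; rewrite /arrow_weight (negPf tsV) /incidence ts facet_asym //.
by case: ifP; rewrite subr0.
Qed.

Lemma arrow_weight_up s t : (s, t) \in V -> arrow_weight s t = - facet_sign s t.
Proof.
move=> stV; rewrite /arrow_weight stV pairs_asym // /incidence.
by rewrite facet_asym (pair_facet stV) ?sub0r // pair_facet.
Qed.

Lemma arrow_weight_arrow s t : arrow_weight s t != 0 -> arrow s t.
Proof.
rewrite /arrow_weight /hasse_arrow; case: ifP => _; case: ifP => _.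
all: rewrite ?orbT ?subrr ?subr0 ?eqxx //.
by move/incidence_facet->.
Qed.

Lemma arrow_weight_descends s t : arrow_weight s t != 0 -> descends s t.
Proof. by move/arrow_weight_arrow/arrow_descends. Qed.

(** * Path sums as cochains *)

Let phi := flow arrow_weight.
Let phi_rec := flow_rec descends_trans descends_irr arrow_weight_descends.
Let phi_refl s : phi s s = 1 :=
  flow_refl descends_trans descends_irr arrow_weight_descends s.

(** Upward steps start at lower simplices and end at upper ones, so two of them
never follow each other: along a path to a critical simplex each rise in
dimension is compensated by a later drop, and a path that does not start with a
rise drops once more. *)
Lemma path_dim s q : path arrow s q -> q != [::] -> critical (last s q) ->
  dim (last s q) + (~~ lower s)%:R <= dim s.
Proof.
elim: q s => //= x q IH s /andP[sx pq] _ crit.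
have IHx : q != [::] -> dim (last x q) + (~~ lower x)%:R <= dim x.
  by move=> q0; apply: IH.
case/orP: sx => [/andP[/facet_dim -> _]|sxV].
  rewrite lerD //; last by case: lower.
  case: q IHx {IH pq crit} => //= y q /(_ isT); apply: le_trans.
  by rewrite lerDl.
have -> : lower s by apply/existsP; exists x.
have lowx : ~~ lower x by apply/existsPn=> u; apply: pairs_disjoint sxV.
rewrite addr0 -(lerD2r 1) -(facet_dim (pair_facet sxV)).
rewrite lowx in IHx; apply: IHx; apply: contraTneq crit => ->.
by apply/negP=> /(critical_unpaired s)[_]; rewrite sxV.
Qed.

Lemma phi_dim0 s t : critical t -> s != t ->
  dim s < dim t + (~~ lower s)%:R -> phi s t = 0.
Proof.
move=> ct st lt_dim; apply: pathsum_eq0 => q.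
move/(sub_path arrow_weight_arrow)=> pq; apply: contraTN lt_dim => /eqP last_q.
rewrite -leNgt -last_q path_dim // ?last_q //.
by apply: contraNneq st => q0; rewrite -last_q q0.
Qed.

Definition coboundary (g : {set T} -> int) s : int :=
  \sum_x incidence K s x * g x.

(** Expanding [phi s t] by its first step gives the coboundary, except that the
gradient partner [l] of [s] is missing.  The only path step from [l] that
contributes goes back up to [s], with weight minus the incidence number, so the
missing term is [- phi s t]. *)
Lemma coboundary_flow s t : critical t -> ~~ lower s -> dim s = dim t + 1 ->
  coboundary (phi^~ t) s = if critical s then phi s t else 0.
Proof.
move=> ct lows dim_s.
have st : (s == t) = false.
  have lt_ts : dim t < dim s by rewrite dim_s ltrDl.
  by apply: contraTF lt_ts => /eqP->; rewrite ltxx.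
have phi_s : phi s t = \sum_(x | (x, s) \notin V) incidence K s x * phi x t.
  rewrite /phi phi_rec st add0r [RHS]big_mkcond; apply: eq_bigr => x _.
  rewrite /arrow_weight (negPf (existsPn lows x)) subr0.
  by case: ifP => //=; rewrite mul0r.
have [cs|ncs] := boolP (critical s).
  rewrite phi_s; apply: eq_bigl => x.
  by rewrite (critical_unpaired x cs).2.
have [sK|sK] := boolP (s \in K); last first.
  apply: big1 => x _; rewrite /incidence /facet (negPf sK) andbF.
  by rewrite mul0r.
have [l lsV] : exists l, (l, s) \in V.
  apply/existsP; apply: contraNT ncs => /existsPn; exact: unpaired_critical.
have lt' : (l == t) = false.
  by apply: contraTF lsV => /eqP->; rewrite (critical_unpaired s ct).1.
have phi_l : phi l t = - incidence K s l * phi s t.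
  rewrite {1}/phi phi_rec lt' add0r (bigD1 s) //= big1 ?addr0.
    by rewrite arrow_weight_up // /incidence (pair_facet lsV).
  move=> x xs; have [->|] := eqVneq (arrow_weight l x) 0; first by rewrite mul0r.
  move/arrow_weight_arrow/orP=> [/andP[/facet_dim xl _]|lxV]; last first.
    by rewrite (pair_top_inj lxV lsV) eqxx in xs.
  rewrite -/(phi x t).
  have lt_xt : dim x < dim t.
    have := facet_dim (pair_facet lsV); rewrite dim_s => /addIr ->.
    by rewrite xl ltrDl.
  rewrite phi_dim0 ?mulr0 //; last by rewrite ltr_wpDr.
  by apply: contraTneq lt_xt => ->; rewrite ltxx.
rewrite /coboundary (bigD1 l) //= phi_l mulrA mulrN.
have -> : incidence K s l * incidence K s l = 1.
  by rewrite /incidence (pair_facet lsV) -expr2 sqrr_sign.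
rewrite mulN1r phi_s addrC; apply/eqP; rewrite subr_eq0; apply/eqP.
apply: eq_bigl => x; congr (~~ _); apply/eqP/idP => [->//|xsV].
exact: pair_bottom_inj xsV lsV.
Qed.

Lemma flow_comp alpha gamma : critical alpha -> critical gamma ->
    dim alpha = dim gamma + 1 + 1 ->
  \sum_(beta in critical_simplices K f (dim gamma + 1))
    phi alpha beta * phi beta gamma = 0.
Proof.
move=> ca cg dim_a; set B := critical_simplices _ _ _.
have BP b : b \in B -> critical b /\ dim b = dim gamma + 1.
  by rewrite inE => /andP[? /eqP].
pose h s := coboundary (phi^~ gamma) s - \sum_(b in B) phi b gamma * phi s b.
have coboundary_h u : ~~ lower u -> dim u = dim gamma + 1 + 1 ->
    coboundary h u
    = - \sum_(b in B) phi b gamma * (if critical u then phi u b else 0).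
  move=> lowu dim_u; rewrite /coboundary /h.
  under eq_bigr => x _ do rewrite mulrBr.
  rewrite sumrB; under eq_bigr => x _ do rewrite mulr_sumr.
  rewrite exchange_big /= big1 ?sub0r; last first.
    move=> y _; under eq_bigr => x _ do rewrite mulrA.
    by rewrite -mulr_suml incidence_comp ?mul0r.
  congr (- _); under eq_bigr => x _ do rewrite mulr_sumr.
  rewrite exchange_big; apply: eq_bigr => b /BP[cb dim_b].
  rewrite -coboundary_flow ?dim_b // mulr_sumr; apply: eq_bigr => x _.
  by rewrite mulrCA.
have h_upper s : ~~ lower s -> dim s = dim gamma + 1 -> h s = 0.
  move=> lows dim_s; rewrite /h coboundary_flow //.
  have phi0 b : b \in B -> b != s -> phi s b = 0.
    case/BP=> cb dim_b bs; apply: phi_dim0; rewrite // 1?eq_sym //.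
    by rewrite lows dim_s dim_b ltrDl.
  have [cs|ncs] := boolP (critical s).
    rewrite (bigD1 s) /= ?inE ?cs ?dim_s ?eqxx //.
    rewrite phi_refl mulr1 big1 ?addr0 ?subrr // => b /andP[bB bs].
    by rewrite phi0 ?mulr0.
  rewrite big1 ?subrr // => b bB; rewrite phi0 ?mulr0 //.
  by apply: contraNneq ncs => <-; case/BP: bB.
have h0 s : dim s = dim gamma + 1 -> h s = 0.
  (* For a lower [s] with partner [u], all other facets of [u] lie below [s] in
     the flow order, and the incidence number of [s] in [u] is a unit. *)
  elim/(acyclic_ind descends_trans descends_irr): s => s IH dim_s.
  have [/existsP[u suV]|] := boolP (lower s); last by move/h_upper; apply.
  have su := pair_facet suV.
  have lowu : ~~ lower u by apply/existsPn=> v; apply: pairs_disjoint suV.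
  have ncu : critical u = false.
    by apply/negP=> /(critical_unpaired s)[_]; rewrite suV.
  have := coboundary_h u lowu; rewrite (facet_dim su) dim_s => /(_ erefl).
  rewrite ncu big1 ?oppr0; last by move=> b _; rewrite mulr0.
  rewrite /coboundary (bigD1 s) //= big1 ?addr0.
    by move/eqP; rewrite mulf_eq0 /incidence su signr_eq0 => /eqP.
  move=> x xs; have [->|/incidence_facet xu] := eqVneq (incidence K u x) 0.
    by rewrite mul0r.
  rewrite IH ?mulr0 //; last first.
    by apply: (addIr 1); rewrite -(facet_dim xu) (facet_dim su) dim_s.
  apply: descends_trans (arrow_descends _) (arrow_descends _).
    by apply/orP; right; apply: suV.
  rewrite /hasse_arrow xu; apply/orP; left; apply/negP=> xuV.
  by rewrite (pair_bottom_inj xuV suV) eqxx in xs.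
have := coboundary_h alpha (critical_lowerN ca) dim_a; rewrite ca.
rewrite {1}/coboundary big1.
  move/esym/eqP; rewrite oppr_eq0 => /eqP sum0; rewrite -[RHS]sum0.
  by apply: eq_bigr => b _; rewrite mulrC.
move=> x _; have [->|/incidence_facet xa] := eqVneq (incidence K alpha x) 0.
  by rewrite mul0r.
by rewrite h0 ?mulr0 //; apply: (addIr 1); rewrite -(facet_dim xa) dim_a.
Qed.

(** * Signs of paths and critical flowlines *)

(** [k] counts the upward steps, which is the exponent in [path_sign]. *)
Lemma path_weight_sign s q : path arrow s q ->
  exists k : nat,
    path_weight arrow_weight s q
    = (\prod_(a <- zip (s :: q) q) arrow_sign a.1 a.2) * (-1) ^+ k
    /\ (size q)%:Z - (dim s - dim (last s q)) = k%:Z * 2.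
Proof.
elim: q s => [|x q IH] s /=.
  by exists 0%N; rewrite /path_weight !big_nil mul1r mul0r subrr.
case/andP=> sx /IH[k [weight_q size_q]].
have split_last : dim s - dim (last x q) = dim s - dim x + (dim x - dim (last x q)).
  by rewrite addrA subrK.
rewrite path_weight_cons weight_q big_cons /= {}split_last -addn1 PoszD.
case/orP: sx => [/andP[xs xsV]|sxV].
  exists k; rewrite arrow_weight_down // /arrow_sign.
  case/and4P: (xs) => _ _ -> _; rewrite mulrA; split=> //.
  by rewrite (facet_dim xs) -size_q [dim x + 1]addrC addrK opprD addrA addrK.
exists k.+1; rewrite arrow_weight_up // /arrow_sign.
have -> : (x \subset s) = false.
  apply/negP=> /subset_leq_card; have := facet_dim_lt (pair_facet sxV).
  by rewrite ltrD2r ltz_nat ltnNge => /negP.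
rewrite exprS mulN1r mulrN !mulNr mulrA; split=> //.
rewrite -[k.+1]addn1 (PoszD k) mulrDl -size_q mul1r (facet_dim (pair_facet sxV)).
have -> : dim s - (dim s + 1) = -1 by rewrite opprD addrA subrr sub0r.
move: (size q)%:Z => m.
by rewrite opprD opprK addrA -[m + 1 + 1]addrA addrAC.
Qed.

Lemma path_sign_weight s q : path arrow s q ->
  path_sign (s :: q) = path_weight arrow_weight s q.
Proof.
case/path_weight_sign=> k [-> size_q].
by rewrite /path_sign /path_length /path_index /= size_q mulzK.
Qed.

Section CriticalFlowlines.
Variables alpha gamma : {set T}.
Hypotheses (ca : critical alpha) (cg : critical gamma).
Hypothesis dim_a : dim alpha = dim gamma + 1 + 1.
Let B := critical_simplices K f (dim gamma + 1).

(** By [path_dim], any nontrivial path between critical simplices drops in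
dimension.  Hence a critical simplex strictly inside a path of index 2 has the
middle dimension.  Conversely, such a simplex is unpaired, so the arrows before
and after it point down and form a double drop. *)
Lemma critical_flowlineE q : path arrow alpha q -> last alpha q = gamma ->
  critical_flowline K f alpha gamma (alpha :: q) = has (mem B) (alpha :: q).
Proof.
move=> pq last_q; rewrite /critical_flowline /flowline ca cg /= last_q pq !eqxx.
have -> /= : path_index (alpha :: q) == 2.
  by rewrite /path_index /= last_q dim_a -[_ + 1 + 1]addrA addrAC subrr.
have aB : (alpha \in B) = false.
  by rewrite inE ca dim_a /= -subr_eq0 addrAC subrr.
rewrite aB /=; apply/existsP/hasP => [[b /andP[]]|[b bq]].
  case/existsP=> a /existsP[c /and3P[inf _ _]] cb.
  have [q1 [q2 def_q]] : exists q1 q2, q = rcons q1 b ++ c :: q2.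
    case/infixP: inf => -[|x p1] [p3 [_ ->]]; first by exists [::], p3.
    by exists (rcons p1 a), p3; rewrite -!cats1 -!catA.
  exists b; first by rewrite def_q mem_cat mem_rcons mem_head.
  rewrite /= inE cb /=; move: pq last_q; rewrite def_q cat_path last_cat last_rcons.
  case/andP=> pab pbg last_g.
  have := path_dim pab; have := path_dim pbg.
  rewrite last_rcons last_g !critical_lowerN // => /(_ isT cg) le_gb.
  rewrite dim_a lerD2r => le_bg; apply/eqP/le_anti/andP; split=> //.
  by apply: le_bg; case: (q1).
rewrite /= inE => /andP[cb /eqP dim_b]; exists b; rewrite cb andbT.
have gb : gamma != b.
  apply: contraTneq isT => gb; have : dim gamma < dim b by rewrite dim_b ltrDl.
  by rewrite gb ltxx.
case/splitPr: bq pq last_q => q1 [|c q2].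
  by rewrite last_cat /= => _ /esym/eqP; rewrite (negPf gb).
rewrite cat_path /= => /and4P[_ ab bc _] _.
apply/existsP; exists (last alpha q1); apply/existsP; exists c.
have cN x := critical_unpaired x cb.
move: ab bc; rewrite /hasse_arrow !(cN _).1 !(cN _).2 !orbF !andbT => ab bc.
rewrite ab bc !andbT -cat_cons [alpha :: q1]lastI cat_rcons.
by apply/infixP; exists (belast alpha q1), q2.
Qed.

Lemma sum_path_sign :
  \sum_(F in critical_flowlines K f alpha gamma) path_sign F = 0.
Proof.
apply: etrans (flow_comp ca cg dim_a).
rewrite -(pathsum_through descends_trans descends_irr arrow_weight_descends);
  last first.
  move=> b c; rewrite !inE => /andP[cb /eqP dim_b] /andP[cc /eqP dim_c] bc.
  by apply: phi_dim0 => //; rewrite critical_lowerN // dim_b dim_c ltrDl.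
pose Fs := enum (critical_flowlines K f alpha gamma).
have FsP F : F \in Fs -> exists2 q : seq {set T}, val F = alpha :: q
    & [/\ path arrow alpha q, last alpha q = gamma & has (mem B) (alpha :: q)].
  rewrite mem_enum inE /= => cF; have /and3P[flF _ _] := cF.
  case: F flF cF => -[|x q] szq /= /and5P[_ _ //= _ /eqP hd].
  case/andP=> /eqP last_q pq; rewrite {}hd in last_q pq * => cF.
  by exists q => //; split=> //; have := critical_flowlineE pq last_q; rewrite cF.
rewrite (@pathsum_seq _ _ _ _ descends_trans descends_irr
  arrow_weight_descends _ _ [seq behead (val F) | F <- Fs]).
- rewrite big_map -big_enum -/Fs big_seq [RHS]big_seq_cond /=.
  apply: eq_big => F; last by move=> /FsP[q -> [pq _ _]]; apply: path_sign_weight.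
  case: (boolP (F \in Fs)) => //= /FsP[q -> [_ /= -> ->]].
  by rewrite eqxx.
- rewrite map_inj_in_uniq ?enum_uniq // => F G /FsP[q eF _] /FsP[q' eG _].
  by rewrite eF eG /= => eq_q; apply: val_inj; rewrite eF eG eq_q.
move=> q /path_weight_neq0/(sub_path arrow_weight_arrow) pq /andP[/eqP last_q qB].
have : critical_flowline K f alpha gamma (alpha :: q).
  by rewrite critical_flowlineE.
case/mem_critical_flowlines=> F Fin eF.
by apply/mapP; exists F; [rewrite mem_enum | exact: (congr1 behead eF)].
Qed.
End CriticalFlowlines.
End GradientFlow.

Theorem theorem5p1 (R : realType) (disp : Order.disp_t)
    (T : finOrderType disp) (K : {set {set T}}) (f : {set T} -> R)
    (n : nat) (alpha : {set T}) :
  simplicial_complex K ->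
  discrete_morse_function K f ->
  alpha \in critical_simplices K f (n%:Z + 1) ->
  \sum_(gamma : {s : {set T} | s \in critical_simplices K f (n%:Z - 1)})
    \sum_(F in critical_flowlines K f alpha (val gamma))
      path_sign F *: << gamma >>
  = 0 :> {freeg {s : {set T} | s \in critical_simplices K f (n%:Z - 1)}}.
Proof.
move=> Kc fM; rewrite inE => /andP[ca /eqP dim_a].
apply: big1 => -[gamma gP] _ /=; rewrite -scaler_suml.
have /andP[cg /eqP dim_g] : critical K f gamma && (simplex_dim gamma == n%:Z - 1).
  by move: gP; rewrite inE.
by rewrite (sum_path_sign Kc fM ca cg) ?scale0r // dim_g subrK dim_a.
Qed.
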